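(* Let $K$ be an algebraically closed field of characteristic $0$, let $(V,\rho)$ be a strictly indecomposable representation of the braid group $B_3$ over $K$ with $\dim(V)=n=3$, and let $W$ be a non-zero invariant subspace of $V$ of minimal dimension. Suppose $\dim(W)=1$. Then, up to equivalence, the matrices $A$ of $\rho(\sigma_1)$ and $B$ of $\rho(\sigma_2)$ have one of the following forms, where in each case the $\lambda_i\in K$ that occur are mutually different and non-zero: (1) $A=\begin{pmatrix}\lambda_1&0&0\\0&\lambda_2&0\\0&0&\lambda_3\end{pmatrix}$ and $B$ is one of: (1.1) $B=\begin{pmatrix}\lambda_1&1&1\\0&\lambda_2&0\\0&0&\lambda_3\end{pmatrix}$, with $\lambda_2=\lambda_1e^{\pm\pi i/3}$, $\lambda_3=\lambda_1e^{\mp\pi i/3}$; (1.2) $B=\begin{pmatrix}\lambda_1&0&1\\0&\lambda_2&1\\0&0&\lambda_3\end{pmatrix}$, with $\lambda_1=\lambda_3e^{\pm\pi i/3}$, $\lambda_2=\lambda_3e^{\mp\pi i/3}$; (1.3) $B=\begin{pmatrix}\lambda_1&1&1\\0&\lambda_2&2\lambda_2\\0&0&\lambda_3\end{pmatrix}$, with $\lambda_1=\lambda_2e^{\pm\pi i/3}$, $\lambda_3=\lambda_2e^{\mp\pi i/3}$; (1.4) $B=\begin{pmatrix}\lambda_1&1&\frac{-\lambda_2^2(\lambda_1^2-\lambda_1\lambda_2+\lambda_2^2)}{\lambda_1(\lambda_1^2+\lambda_2^2)}\\0&\frac{-\lambda_1^4}{\lambda_2(\lambda_1^2+\lambda_2^2)}&\frac{\lambda_1^2(\lambda_1^4+\lambda_1^2\lambda_2^2+\lambda_2^4)}{(\lambda_1^2+\lambda_2^2)^2}\\0&1&\frac{\lambda_2^3}{\lambda_1^2+\lambda_2^2}\end{pmatrix}$,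 with $\lambda_3=-\frac{\lambda_1^2}{\lambda_2}$. (2) $A=\begin{pmatrix}\lambda_1&0&0\\0&\lambda_1&0\\0&0&\lambda_2\end{pmatrix}$, $B=\begin{pmatrix}\lambda_1&1&\frac{\lambda_1\lambda_2}{\lambda_1-\lambda_2}\\0&\frac{\lambda_2^2}{\lambda_2-\lambda_1}&0\\0&1&\frac{\lambda_1^2}{\lambda_1-\lambda_2}\end{pmatrix}$, with $\lambda_1=\lambda_2e^{\pm\pi i/3}$. (3) $A=\begin{pmatrix}\lambda_1&0&0\\0&\lambda_2&1\\0&0&\lambda_2\end{pmatrix}$ and $B$ is one of: (3.1) $B=\begin{pmatrix}\lambda_1&0&1\\0&\lambda_2&1\\0&0&\lambda_2\end{pmatrix}$, with $\lambda_1=\lambda_2e^{\pm\pi i/3}$; (3.2) $B=\begin{pmatrix}\lambda_1&1&\frac{\lambda_1+\lambda_2}{\lambda_1^2}\\0&\lambda_2&0\\0&\lambda_1^2&\lambda_2\end{pmatrix}$, with $\lambda_2=\lambda_1e^{\pm\pi i/2}$. (4) $A=\begin{pmatrix}\lambda_1&1&0\\0&\lambda_1&0\\0&0&\lambda_2\end{pmatrix}$ and $B$ is one of: (4.1) $B=\begin{pmatrix}\lambda_1&1+\frac{\lambda_1\beta}{\lambda_2^2}&1\\0&\lambda_1&0\\0&\beta&\lambda_2\end{pmatrix}$, with $\lambda_1=\lambda_2e^{\pm\pi i/3}$ and $\beta\in K$ an arbitrary parameter; (4.2) $B=\begin{pmatrix}\lambda_1&-2&0\\0&\frac{\lambda_2}{2}&1\\0&\frac{3\lambda_2^2}{4}&-\frac{\lambda_2}{2}\end{pmatrix}$,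 with $\lambda_1=-\lambda_2$. (5) $A=B=\begin{pmatrix}\lambda&1&0\\0&\lambda&1\\0&0&\lambda\end{pmatrix}$, with $\lambda\in K^\times$.
   Context: The braid group $B_3$ is the group generated by $\sigma_1,\sigma_2$ subject to the relation $\sigma_1\sigma_2\sigma_1=\sigma_2\sigma_1\sigma_2$. A representation is decomposable if it is the direct sum of two proper non-zero invariant subspaces, and indecomposable otherwise; it is irreducible if its only invariant subspaces are $0$ and $V$. A representation is strictly indecomposable if it is indecomposable but not irreducible. Invariant subspace means invariant under both $\rho(\sigma_1)$ and $\rho(\sigma_2)$. Equivalence of representations means simultaneous conjugation of the matrices $A,B$ by an invertible matrix over $K$. The symbols $e^{\pm\pi i/3}$ denote the two primitive sixth roots of unity in $K$ (mutually inverse), and $e^{\pm\pi i/2}$ the two primitive fourth roots of unity in $K$; either choice of sign is allowed, and where $\pm$ and $\mp$ occur together the signs are opposite. *)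

(* Defs.v *)
From HB Require Import structures.
From mathcomp Require Import all_boot all_order all_algebra.
(* boolp serves only to form the quotient type B3. *)
From mathcomp Require Import boolp.

Set Implicit Arguments.
Unset Strict Implicit.
Unset Printing Implicit Defensive.

Import GRing.Theory.

(** * The braid group on three strands *)

(* The letter (i, b) stands for sigma_1 (i = false) or sigma_2 (i = true),
   inverted when b = true. *)
Definition word := seq (bool * bool).

Inductive braid_cong : word -> word -> Prop :=
| BraidRefl u : braid_cong u u
| BraidSym u v : braid_cong u v -> braid_cong v u
| BraidTrans v u w : braid_cong u v -> braid_cong v w -> braid_cong u w
| BraidCat u u' v v' :
    braid_cong u u' -> braid_cong v v' -> braid_cong (u ++ v) (u' ++ v')
| BraidCancel i b : braid_cong [:: (i, b); (i, ~~ b)] [::]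
| BraidRel :
    braid_cong [:: (false, false); (true, false); (false, false)]
               [:: (true, false); (false, false); (true, false)].

Definition braid_eqb : rel word := fun u v => `[< braid_cong u v >].

Lemma braid_eqb_equiv : equiv_class_of braid_eqb.
Proof.
split=> [u|u v|v u w].
- by apply/asboolP; apply: BraidRefl.
- by apply/asboolP/asboolP; apply: BraidSym.
- by move=> /asboolP uv /asboolP vw; apply/asboolP; apply: BraidTrans uv vw.
Qed.

Canonical braid_eqb_equivRel := EquivRelPack braid_eqb_equiv.

Definition B3 : Type := {eq_quot braid_eqb}%qT.
HB.instance Definition _ := Choice.on B3.

Definition to_B3 (u : word) : B3 := (\pi_({eq_quot braid_eqb}) u)%qT.
Definition of_B3 (x : B3) : word := repr (x : {eq_quot braid_eqb}%qT).

Lemma of_B3K : cancel of_B3 to_B3.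
Proof. by move=> x; apply: reprK. Qed.

Lemma to_B3P u v : to_B3 u = to_B3 v <-> braid_cong u v.
Proof.
split=> [/eqmodP|uv]; first by move=> /asboolP.
by apply/eqmodP/asboolP.
Qed.

Definition invw (u : word) : word := rev [seq (x.1, ~~ x.2) | x <- u].

Lemma invw_cong u v : braid_cong u v -> braid_cong (invw u) (invw v).
Proof.
elim=> {u v} [u|u v _|v u w _ uv _ vw|u u' v v' _ uu' _ vv'|i b|].
- exact: BraidRefl.
- exact: BraidSym.
- exact: BraidTrans uv vw.
- by rewrite /invw !map_cat !rev_cat; apply: BraidCat.
- by have := BraidCancel i b; rewrite /invw /rev /= negbK.
- rewrite /invw /rev /=.
  set a := (false, true); set b := (true, true).
  pose A := (false, false); pose B := (true, false).
  (* u^-1 = u^-1 (v v^-1) ~ (u^-1 u) v^-1 = v^-1 for u = ABA, v = BAB *)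
  have ca : braid_cong [:: A; a] [::] := BraidCancel false false.
  have cb : braid_cong [:: B; b] [::] := BraidCancel true false.
  have ac : braid_cong [:: a; A] [::] := BraidCancel false true.
  have bc : braid_cong [:: b; B] [::] := BraidCancel true true.
  have mid x y s t : braid_cong [:: x; y] [::] ->
      braid_cong (s ++ [:: x, y & t]) (s ++ t).
    move=> xy; apply: BraidCat; first exact: BraidRefl.
    by apply: (@BraidCat _ [::] t t xy); apply: BraidRefl.
  have vv : braid_cong [:: B; A; B; b; a; b] [::].
    apply: BraidTrans (mid _ _ [:: B; A] [:: a; b] cb) _.
    exact: BraidTrans (mid _ _ [:: B] [:: b] ca) cb.
  have uu : braid_cong [:: a; b; a; A; B; A] [::].
    apply: BraidTrans (mid _ _ [:: a; b] [:: B; A] ac) _.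
    exact: BraidTrans (mid _ _ [:: a] [:: A] bc) ac.
  apply: (@BraidTrans ([:: a; b; a] ++ ([:: B; A; B] ++ [:: b; a; b]))).
    rewrite -{1}[[:: a; b; a]]cats0.
    by apply: BraidCat; [apply: BraidRefl | apply: BraidSym].
  apply: (@BraidTrans ([:: a; b; a] ++ ([:: A; B; A] ++ [:: b; a; b]))).
    apply: BraidCat; first exact: BraidRefl.
    by apply: BraidCat; [apply: BraidSym; apply: BraidRel | apply: BraidRefl].
  by apply: (@BraidCat [:: a; b; a; A; B; A] [::] _ [:: b; a; b] uu);
     apply: BraidRefl.
Qed.

Lemma invw_cancel u : braid_cong (invw u ++ u) [::].
Proof.
elim: u => [|[i b] u IH]; first exact: BraidRefl.
rewrite /invw /= rev_cons -/(invw u) cat_rcons.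
apply: BraidTrans IH; apply: BraidCat; first exact: BraidRefl.
rewrite -[X in _ _ X]cat0s -[[:: _, _ & _]]/([:: (i, ~~ b); (i, b)] ++ u).
apply: BraidCat; last exact: BraidRefl.
by have := BraidCancel i (~~ b); rewrite negbK.
Qed.

Definition B3_one : B3 := to_B3 [::].
Definition B3_mul (x y : B3) : B3 := to_B3 (of_B3 x ++ of_B3 y).
Definition B3_inv (x : B3) : B3 := to_B3 (invw (of_B3 x)).

Lemma of_to_B3 u : braid_cong (of_B3 (to_B3 u)) u.
Proof. by apply/to_B3P; rewrite of_B3K. Qed.

Lemma to_B3M u v : B3_mul (to_B3 u) (to_B3 v) = to_B3 (u ++ v).
Proof. by apply/to_B3P; apply: BraidCat; apply: of_to_B3. Qed.

Lemma to_B3V u : B3_inv (to_B3 u) = to_B3 (invw u).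
Proof. by apply/to_B3P; apply: invw_cong; apply: of_to_B3. Qed.

Lemma B3_mulA : associative B3_mul.
Proof.
move=> x y z; rewrite -(of_B3K x) -(of_B3K y) -(of_B3K z).
by rewrite !to_B3M catA.
Qed.

Lemma B3_mul1 : left_id B3_one B3_mul.
Proof. by move=> x; rewrite -(of_B3K x) to_B3M. Qed.

Lemma B3_mulr1 : right_id B3_one B3_mul.
Proof. by move=> x; rewrite -(of_B3K x) to_B3M cats0. Qed.

Lemma B3_mulV : left_inverse B3_one B3_inv B3_mul.
Proof.
move=> x; rewrite -(of_B3K x) to_B3V to_B3M.
by apply/to_B3P; apply: invw_cancel.
Qed.

Lemma B3_mulrV : right_inverse B3_one B3_inv B3_mul.
Proof.
move=> x; rewrite -[LHS]B3_mul1 -(B3_mulV (B3_inv x)) -B3_mulA.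
by rewrite (B3_mulA (B3_inv x)) B3_mulV B3_mul1.
Qed.

HB.instance Definition _ := isGroup.Build B3
  B3_mulA B3_mul1 B3_mulr1 B3_mulV B3_mulrV.

Definition sigma1 : B3 := to_B3 [:: (false, false)].
Definition sigma2 : B3 := to_B3 [:: (true, false)].

Lemma B3_braid : (sigma1 * sigma2 * sigma1 = sigma2 * sigma1 * sigma2)%g.
Proof.
have M u v : (to_B3 u * to_B3 v)%g = to_B3 (u ++ v) := to_B3M u v.
rewrite /sigma1 /sigma2 !(M [:: _] [:: _]) !(M [:: _; _] [:: _]).
by apply/to_B3P; apply: BraidRel.
Qed.

Lemma B3_lift (G : groupType) (g1 g2 : G) :
  (g1 * g2 * g1 = g2 * g1 * g2)%g ->
  exists f : B3 -> G, [/\ f sigma1 = g1, f sigma2 = g2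
    & forall x y, f (x * y)%g = (f x * f y)%g].
Proof.
move=> g12.
pose ev1 (x : bool * bool) : G :=
  let g := if x.1 then g2 else g1 in if x.2 then (g^-1)%g else g.
pose ev (u : word) : G := foldr (fun x h => (ev1 x * h)%g) 1%g u.
have evM u v : ev (u ++ v) = (ev u * ev v)%g.
  by elim: u => [|x u IH] /=; rewrite ?mul1g // IH mulgA.
have evP u v : braid_cong u v -> ev u = ev v.
  elim=> {u v} [//|//|v u w _ -> _ -> //|u u' v v' _ uu' _ vv'|i b|].
  - by rewrite !evM uu' vv'.
  - by case: i b => [] [] /=; rewrite /ev1 /= mulg1 ?mulgV ?mulVg.
  - by rewrite /= /ev1 /= !mulg1 !mulgA.
exists (fun x => ev (of_B3 x)); split.
- by rewrite (evP _ _ (of_to_B3 _)) /= mulg1.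
- by rewrite (evP _ _ (of_to_B3 _)) /= mulg1.
- by move=> x y; rewrite -evM; apply: evP; apply: of_to_B3.
Qed.

(** * Representations *)

Local Open Scope ring_scope.

(* A homomorphism from B3 to End(V) preserving 1 takes its values in GL(V). *)
Record representation (K : fieldType) (V : vectType K) := Representation {
  rep_fun :> B3 -> 'End(V);
  rep1 : rep_fun 1%g = \1%VF;
  repM : forall x y : B3, rep_fun (x * y)%g = (rep_fun x \o rep_fun y)%VF
}.

Section Representations.

Variables (K : fieldType) (V : vectType K) (rho : representation V).

Definition invariant_subspace (U : {vspace V}) : Prop :=
  (rho sigma1 @: U <= U)%VS /\ (rho sigma2 @: U <= U)%VS.

Definition decomposable_rep : Prop :=
  exists U1 U2 : {vspace V},
    [/\ invariant_subspace U1 /\ invariant_subspace U2,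
        U1 <> 0%VS /\ U2 <> 0%VS,
        U1 <> fullv /\ U2 <> fullv
      & (U1 :&: U2)%VS = 0%VS /\ (U1 + U2)%VS = fullv].

Definition irreducible_rep : Prop :=
  forall U : {vspace V}, invariant_subspace U -> U = 0%VS \/ U = fullv.

Definition strictly_indecomposable : Prop :=
  ~ decomposable_rep /\ ~ irreducible_rep.

Definition minimal_invariant (W : {vspace V}) : Prop :=
  [/\ invariant_subspace W, W <> 0%VS
    & forall U, invariant_subspace U -> U <> 0%VS -> (\dim W <= \dim U)%N].

End Representations.

(** * Matrices *)

(* Matrices act on column vectors: column j holds the coordinates of the
   image of the j-th basis vector (mxof is the transpose of this). *)
Definition matrix_in_basis (K : fieldType) (V : vectType K) (n : nat)
    (e : n.-tuple V) (f : 'End(V)) : 'M[K]_n :=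
  \matrix_(i, j) coord e i (f e`_j).

Definition equivalent_pairs (K : fieldType) (n : nat)
    (A B A' B' : 'M[K]_n) : Prop :=
  exists2 P : 'M[K]_n, P \in unitmx
    & A' = invmx P *m A *m P /\ B' = invmx P *m B *m P.

Definition mx3 (K : fieldType) (rows : seq (seq K)) : 'M[K]_3 :=
  \matrix_(i, j) (nth [::] rows i)`_j.

Definition distinct_nonzero (K : fieldType) (s : seq K) : Prop :=
  uniq s /\ 0 \notin s.

(* z stands for e^{+-pi i/3} (order 6) or e^{+-pi i/2} (order 4), with either
   sign allowed; z^-1 is then the root with the opposite sign. *)
Variant normal_form (K : fieldType) : 'M[K]_3 -> 'M[K]_3 -> Prop :=
| Form11 (l1 l2 l3 z : K) of distinct_nonzero [:: l1; l2; l3]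
    & 6.-primitive_root z & l2 = l1 * z & l3 = l1 * z^-1 :
    normal_form
      (mx3 [:: [:: l1; 0; 0]; [:: 0; l2; 0]; [:: 0; 0; l3]])
      (mx3 [:: [:: l1; 1; 1]; [:: 0; l2; 0]; [:: 0; 0; l3]])
| Form12 (l1 l2 l3 z : K) of distinct_nonzero [:: l1; l2; l3]
    & 6.-primitive_root z & l1 = l3 * z & l2 = l3 * z^-1 :
    normal_form
      (mx3 [:: [:: l1; 0; 0]; [:: 0; l2; 0]; [:: 0; 0; l3]])
      (mx3 [:: [:: l1; 0; 1]; [:: 0; l2; 1]; [:: 0; 0; l3]])
| Form13 (l1 l2 l3 z : K) of distinct_nonzero [:: l1; l2; l3]
    & 6.-primitive_root z & l1 = l2 * z & l3 = l2 * z^-1 :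
    normal_form
      (mx3 [:: [:: l1; 0; 0]; [:: 0; l2; 0]; [:: 0; 0; l3]])
      (mx3 [:: [:: l1; 1; 1]; [:: 0; l2; 2 * l2]; [:: 0; 0; l3]])
| Form14 (l1 l2 l3 : K) of distinct_nonzero [:: l1; l2; l3]
    & l3 = - (l1 ^+ 2 / l2) :
    normal_form
      (mx3 [:: [:: l1; 0; 0]; [:: 0; l2; 0]; [:: 0; 0; l3]])
      (mx3 [:: [:: l1;
                   1;
                   - l2 ^+ 2 * (l1 ^+ 2 - l1 * l2 + l2 ^+ 2)
                     / (l1 * (l1 ^+ 2 + l2 ^+ 2))];
               [:: 0;
                   - l1 ^+ 4 / (l2 * (l1 ^+ 2 + l2 ^+ 2));
                   l1 ^+ 2 * (l1 ^+ 4 + l1 ^+ 2 * l2 ^+ 2 + l2 ^+ 4)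
                     / (l1 ^+ 2 + l2 ^+ 2) ^+ 2];
               [:: 0; 1; l2 ^+ 3 / (l1 ^+ 2 + l2 ^+ 2)]])
| Form2 (l1 l2 z : K) of distinct_nonzero [:: l1; l2]
    & 6.-primitive_root z & l1 = l2 * z :
    normal_form
      (mx3 [:: [:: l1; 0; 0]; [:: 0; l1; 0]; [:: 0; 0; l2]])
      (mx3 [:: [:: l1; 1; l1 * l2 / (l1 - l2)];
               [:: 0; l2 ^+ 2 / (l2 - l1); 0];
               [:: 0; 1; l1 ^+ 2 / (l1 - l2)]])
| Form31 (l1 l2 z : K) of distinct_nonzero [:: l1; l2]
    & 6.-primitive_root z & l1 = l2 * z :
    normal_form
      (mx3 [:: [:: l1; 0; 0]; [:: 0; l2; 1]; [:: 0; 0; l2]])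
      (mx3 [:: [:: l1; 0; 1]; [:: 0; l2; 1]; [:: 0; 0; l2]])
| Form32 (l1 l2 z : K) of distinct_nonzero [:: l1; l2]
    & 4.-primitive_root z & l2 = l1 * z :
    normal_form
      (mx3 [:: [:: l1; 0; 0]; [:: 0; l2; 1]; [:: 0; 0; l2]])
      (mx3 [:: [:: l1; 1; (l1 + l2) / l1 ^+ 2];
               [:: 0; l2; 0];
               [:: 0; l1 ^+ 2; l2]])
| Form41 (l1 l2 beta z : K) of distinct_nonzero [:: l1; l2]
    & 6.-primitive_root z & l1 = l2 * z :
    normal_form
      (mx3 [:: [:: l1; 1; 0]; [:: 0; l1; 0]; [:: 0; 0; l2]])
      (mx3 [:: [:: l1; 1 + l1 * beta / l2 ^+ 2; 1];
               [:: 0; l1; 0];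
               [:: 0; beta; l2]])
| Form42 (l1 l2 : K) of distinct_nonzero [:: l1; l2] & l1 = - l2 :
    normal_form
      (mx3 [:: [:: l1; 1; 0]; [:: 0; l1; 0]; [:: 0; 0; l2]])
      (mx3 [:: [:: l1; - 2; 0];
               [:: 0; l2 / 2; 1];
               [:: 0; 3 * l2 ^+ 2 / 4; - (l2 / 2)]])
| Form5 (l : K) of l != 0 :
    normal_form
      (mx3 [:: [:: l; 1; 0]; [:: 0; l; 1]; [:: 0; 0; l]])
      (mx3 [:: [:: l; 1; 0]; [:: 0; l; 1]; [:: 0; 0; l]]).

(* Main.v *)
Require Import Defs.
From HB Require Import structures.
From mathcomp Require Import all_boot all_order all_algebra.
From mathcomp Require Import ring.

Set Implicit Arguments.
Unset Strict Implicit.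
Unset Printing Implicit Defensive.

Import GRing.Theory.
Local Open Scope ring_scope.

(** The line W is spanned by a common eigenvector of rho(sigma_1) and
    rho(sigma_2), so in a suitable basis the two matrices are
<<
        [ l u1 u2 ]            [ l' v1 v2 ]
    A = [ 0  a  x ],       B = [ 0  p  q  ],
        [ 0  0  b ]            [ 0  r  s  ]
>>
    where the quotient block of A has been made triangular by solving a
    quadratic equation.  The braid relation forces l' = l, and since
    B = (AB) A (AB)^-1 it also makes the traces and determinants agree; all
    this amounts to a short list of scalar equations, [braid_eqs].  Write
    D and M for the quotient blocks of A and B, and v for (v1, v2).

    Further changes of basis fixing the line of e_1 bring A to one of five
    shapes, according to the coincidences among l, a, b and to whether D is
    diagonalizable.

    - D scalar: then M = D, and the first rows of A and B are proportional up
      to a change of basis, so that some line in the span of e_2 and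
      e_3 is a direct summand ([classify_scalar]).
    - l, a, b distinct: A is diagonal and v (D M - l D + l^2) = 0.  If r <> 0,
      then M is determined by a, b and the product q r.  The determinant of
      D M - l D + l^2 is (l^2 + a b) (l - a) (l - b), so either v = 0 and
      e_1 splits off, or l^2 = - a b, which is form (1.4).  The case q <> 0
      reduces to r <> 0 by exchanging e_2 and e_3; if q = r = 0 the equations
      give (1.1) or a splitting ([classify_distinct]).  Forms (1.2) and (1.3)
      never have to be produced: their two pairs are, up to equivalence,
      degenerate instances of (1.4).
    - l <> a = b and D a Jordan block: r = 0 gives (3.1), r <> 0 gives (3.2)
      ([classify_jordan_top]).
    - l = a <> b: q <> 0 gives (4.2), and q = 0 gives (2), (3.1) or (4.1)
      ([classify_double]).
    - l = a = b and D a Jordan block: r = 0 forces A = B, hence (5), and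
      r <> 0 forces a splitting ([classify_triple]).

    Each case also has subcases in which the pair splits; otherwise the
    remaining freedom is used up by rescaling the basis.  A pair of matrices
    that splits gives a decomposition of the representation, which is excluded
    by hypothesis ([rep_decomposable]). *)

Local Notation M3 a b c d e f g h i :=
  (mx3 [:: [:: a; b; c]; [:: d; e; f]; [:: g; h; i]]).

(** * Three by three matrices *)

Section Matrices.

Variable K : fieldType.

Lemma mx3_eta (A : 'M[K]_3) :
  A = M3 (A 0 0) (A 0 1) (A 0 2) (A 1 0) (A 1 1) (A 1 2)
         (A 2 0) (A 2 1) (A 2 2).
Proof.
apply/matrixP=> i j; rewrite !mxE.
by case: i => [[|[|[|//]]] ?]; case: j => [[|[|[|//]]] ?] /=;
   congr (A _ _); apply: val_inj.
Qed.

Lemma mx3_inj (a b c d e f g h i a' b' c' d' e' f' g' h' i' : K) :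
  M3 a b c d e f g h i = M3 a' b' c' d' e' f' g' h' i' ->
  [/\ [/\ a = a', b = b' & c = c'], [/\ d = d', e = e' & f = f']
    & [/\ g = g', h = h' & i = i']].
Proof.
move=> /matrixP E; split; split.
- by have := E 0 0; rewrite !mxE.
- by have := E 0 1; rewrite !mxE.
- by have := E 0 2; rewrite !mxE.
- by have := E 1 0; rewrite !mxE.
- by have := E 1 1; rewrite !mxE.
- by have := E 1 2; rewrite !mxE.
- by have := E 2 0; rewrite !mxE.
- by have := E 2 1; rewrite !mxE.
- by have := E 2 2; rewrite !mxE.
Qed.

Lemma mx3_congr (a b c d e f g h i a' b' c' d' e' f' g' h' i' : K) :
  a = a' -> b = b' -> c = c' -> d = d' -> e = e' -> f = f' ->
  g = g' -> h = h' -> i = i' ->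
  M3 a b c d e f g h i = M3 a' b' c' d' e' f' g' h' i'.
Proof. by do 9 move->. Qed.

Lemma mx3_mul (a b c d e f g h i a' b' c' d' e' f' g' h' i' : K) :
  M3 a b c d e f g h i *m M3 a' b' c' d' e' f' g' h' i' =
  M3 (a * a' + b * d' + c * g') (a * b' + b * e' + c * h')
       (a * c' + b * f' + c * i')
     (d * a' + e * d' + f * g') (d * b' + e * e' + f * h')
       (d * c' + e * f' + f * i')
     (g * a' + h * d' + i * g') (g * b' + h * e' + i * h')
       (g * c' + h * f' + i * i').
Proof.
apply/matrixP=> i0 j0; rewrite !mxE !big_ord_recl big_ord0 !mxE addr0 addrA.
by case: i0 => [[|[|[|//]]] ?]; case: j0 => [[|[|[|//]]] ?].
Qed.

Lemma det_mx2 (A : 'M[K]_2) : \det A = A 0 0 * A 1 1 - A 0 1 * A 1 0.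
Proof.
rewrite (expand_det_row _ 0) !big_ord_recl big_ord0 /cofactor !det_mx11 !mxE.
have -> : lift 0 0 = 1 :> 'I_2 by apply: val_inj.
have -> : lift 1 0 = 0 :> 'I_2 by apply: val_inj.
rewrite /=; ring.
Qed.

Lemma det_mx3 (a b c d e f g h i : K) :
  \det (M3 a b c d e f g h i) =
  a * (e * i - f * h) - b * (d * i - f * g) + c * (d * h - e * g).
Proof.
rewrite (expand_det_row _ ord0) !big_ord_recl big_ord0 /cofactor.
rewrite !det_mx2 !mxE /=; ring.
Qed.

Lemma tr_mx3 (a b c d e f g h i : K) :
  \tr (M3 a b c d e f g h i) = a + e + i.
Proof. by rewrite /mxtrace !big_ord_recl big_ord0 !mxE /= addr0 addrA. Qed.

(** * Linear combinations of equations *)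

(** An equation follows from hypotheses l_i = r_i once x - y is a combination
    of the differences l_i - r_i; the coefficients are supplied and the
    remaining identity is left to ring normalization. *)
Lemma lincomb1 (c1 l1 r1 x y : K) :
  l1 = r1 -> x - y = c1 * (l1 - r1) -> x = y.
Proof. by move=> -> /eqP; rewrite subrr mulr0 subr_eq0 => /eqP. Qed.

Lemma lincomb2 (c1 c2 l1 r1 l2 r2 x y : K) :
  l1 = r1 -> l2 = r2 ->
  x - y = c1 * (l1 - r1) + c2 * (l2 - r2) -> x = y.
Proof.
by move=> -> -> E; apply/eqP; rewrite -subr_eq0 E !subrr !mulr0 addr0.
Qed.

Lemma lincomb3 (c1 c2 c3 l1 r1 l2 r2 l3 r3 x y : K) :
  l1 = r1 -> l2 = r2 -> l3 = r3 ->
  x - y = c1 * (l1 - r1) + c2 * (l2 - r2) + c3 * (l3 - r3) -> x = y.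
Proof.
by move=> -> -> -> E; apply/eqP; rewrite -subr_eq0 E !subrr !mulr0 !addr0.
Qed.

Lemma mulf_cancel0 (c x : K) : c != 0 -> c * x = 0 -> x = 0.
Proof. by move=> /negPf c0 /eqP; rewrite mulf_eq0 c0 => /eqP. Qed.

(** * Equivalence of pairs of matrices *)

Lemma equiv_pairsI (A B P A' B' : 'M[K]_3) :
  \det P != 0 -> A *m P = P *m A' -> B *m P = P *m B' ->
  equivalent_pairs A B A' B'.
Proof.
move=> P0 EA EB; have uP : P \in unitmx by rewrite unitmxE unitfE.
by exists P => //; rewrite -!mulmxA EA EB !mulmxA mulVmx // !mul1mx.
Qed.

Lemma equiv_pairs_refl (A B : 'M[K]_3) : equivalent_pairs A B A B.
Proof.
by apply: (@equiv_pairsI A B 1%:M); rewrite ?det1 ?oner_eq0 // mulmx1 mul1mx.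
Qed.

Lemma equiv_pairs_trans (A B A1 B1 A2 B2 : 'M[K]_3) :
  equivalent_pairs A B A1 B1 -> equivalent_pairs A1 B1 A2 B2 ->
  equivalent_pairs A B A2 B2.
Proof.
move=> [P uP [-> ->]] [Q uQ [-> ->]].
apply: (@equiv_pairsI _ _ (P *m Q)).
- by rewrite det_mulmx mulf_neq0 // -unitfE -unitmxE.
- by rewrite !mulmxA (mulmxK uQ) mulmxV // mul1mx -!mulmxA.
- by rewrite !mulmxA (mulmxK uQ) mulmxV // mul1mx -!mulmxA.
Qed.
End Matrices.

(** * Pairs of matrices satisfying the braid relation *)

Section BraidPairs.

Variable K : fieldType.

(** A representation of the braid group on K^3, as a pair of matrices. *)
Definition braid_pair (A B : 'M[K]_3) : Prop :=
  [/\ A \in unitmx, B \in unitmx & A *m B *m A = B *m A *m B].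

Lemma braid_pair_equiv (A B A' B' : 'M[K]_3) :
  braid_pair A B -> equivalent_pairs A B A' B' -> braid_pair A' B'.
Proof.
move=> [uA uB AB] [P uP [-> ->]]; split.
- by rewrite !unitmx_mul unitmx_inv uP uA.
- by rewrite !unitmx_mul unitmx_inv uP uB.
- have cj X Y : invmx P *m X *m P *m (invmx P *m Y *m P)
                = invmx P *m (X *m Y) *m P.
    by rewrite !mulmxA (mulmxK uP).
  by rewrite !cj AB.
Qed.

Lemma braid_pair_det (A B : 'M[K]_3) : braid_pair A B -> \det A = \det B.
Proof.
move=> [uA uB /(congr1 determinant)]; rewrite !det_mulmx => E.
have dA : \det A != 0 by rewrite -unitfE -unitmxE.
have dB : \det B != 0 by rewrite -unitfE -unitmxE.
apply: (mulfI (mulf_neq0 dA dB)); rewrite [RHS](mulrC _ (\det B)) [RHS]mulrA.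
by rewrite E.
Qed.

Lemma braid_pair_tr (A B : 'M[K]_3) : braid_pair A B -> \tr A = \tr B.
Proof.
move=> [uA uB AB].
have uAB : A *m B \in unitmx by rewrite unitmx_mul uA.
have -> : B = A *m B *m A *m invmx (A *m B).
  by rewrite AB -(mulmxA B A B) (mulmxK uAB).
by rewrite -(mulmxA (A *m B)) mxtrace_mulC mulmxKV.
Qed.

(** The scalar content of the braid relation for A = [l u1 u2; 0 a x; 0 0 b]
    and B = [l v1 v2; 0 p q; 0 r s].  The last six fields are the entries of
    A B A = B A B outside the first column; [be_tr] and [be_det] compare the
    traces and determinants, and [be_l], [be_a], [be_b] express that A is
    invertible. *)
Record braid_eqs (l u1 u2 a x b v1 v2 p q r s : K) : Prop := BraidEqs {
  be_l : l != 0;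
  be_a : a != 0;
  be_b : b != 0;
  be_tr : p + s = a + b;
  be_det : p * s - q * r = a * b;
  be_11 : (a * p + x * r) * a = p * (a * p + x * r) + q * (b * r);
  be_12 : (a * p + x * r) * x + (a * q + x * s) * b
          = p * (a * q + x * s) + q * (b * s);
  be_21 : b * r * a = r * (a * p + x * r) + s * (b * r);
  be_22 : b * r * x + b * s * b = r * (a * q + x * s) + s * (b * s);
  be_1 : l ^+ 2 * u1 + l * v1 * a + (u1 * p + u2 * r) * a
         = l ^+ 2 * v1 + l * (u1 * p + u2 * r) + v1 * (a * p + x * r)
           + v2 * (b * r);
  be_2 : l ^+ 2 * u2 + l * (v1 * x + v2 * b) + (u1 * p + u2 * r) * x
           + (u1 * q + u2 * s) * b
         = l ^+ 2 * v2 + l * (u1 * q + u2 * s) + v1 * (a * q + x * s)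
           + v2 * (b * s)
}.

Lemma braid_pair_eqs (l u1 u2 a x b l' v1 v2 p q r s : K) :
  braid_pair (M3 l u1 u2 0 a x 0 0 b) (M3 l' v1 v2 0 p q 0 r s) ->
  l' = l /\ braid_eqs l u1 u2 a x b v1 v2 p q r s.
Proof.
move=> AB; have T := braid_pair_tr AB; have D := braid_pair_det AB.
move: AB => [uA uB E]; move: E T D uA uB.
rewrite !unitmxE !unitfE !tr_mx3 !det_mx3 !mx3_mul => /mx3_inj.
move=> [[E00 E01 E02] [_ E11 E12] [_ E21 E22]] T D.
have -> : l * (a * b - x * 0) - u1 * (0 * b - x * 0) + u2 * (0 * 0 - a * 0)
          = l * a * b by ring.
rewrite !mulf_eq0 !negb_or => /andP[/andP[l0 a0] b0].
have -> : l' * (p * s - q * r) - v1 * (0 * s - q * 0) + v2 * (0 * r - p * 0)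
          = l' * (p * s - q * r) by ring.
rewrite mulf_eq0 negb_or => /andP[l'0 _].
have ll : l' = l.
  apply: (mulfI (mulf_neq0 l0 l'0)).
  by apply: (lincomb1 (c1 := -1) E00); ring.
split=> //; subst l'; split=> //.
- by apply: (lincomb1 (c1 := -1) T); ring.
- by apply: (mulfI l0); apply: (lincomb1 (c1 := -1) D); ring.
- by apply: (lincomb1 (c1 := 1) E11); ring.
- by apply: (lincomb1 (c1 := 1) E12); ring.
- by apply: (lincomb1 (c1 := 1) E21); ring.
- by apply: (lincomb1 (c1 := 1) E22); ring.
- by apply: (lincomb1 (c1 := 1) E01); ring.
- by apply: (lincomb1 (c1 := 1) E02); ring.
Qed.

(** Up to equivalence, A and B are both block diagonal with blocks of sizes
    1 and 2; in dimension 3 every decomposition has these dimensions. *)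
Definition decomposable_pair (A B : 'M[K]_3) : Prop :=
  exists a b c d e a' b' c' d' e',
    equivalent_pairs A B (M3 a 0 0 0 b c 0 d e) (M3 a' 0 0 0 b' c' 0 d' e').

(** The dichotomy to be proved for every braid pair with a common
    eigenvector. *)
Definition classified (A B : 'M[K]_3) : Prop :=
  decomposable_pair A B \/
  exists A' B', normal_form A' B' /\ equivalent_pairs A B A' B'.

Lemma classified_equiv (A B A' B' : 'M[K]_3) :
  equivalent_pairs A B A' B' -> classified A' B' -> classified A B.
Proof.
move=> E [|[A1 [B1 [N E']]]].
  move=> [a [b [c [d [e [a' [b' [c' [d' [e' E']]]]]]]]]]; left.
  by exists a, b, c, d, e, a', b', c', d', e'; apply: equiv_pairs_trans E E'.
by right; exists A1, B1; split=> //; apply: equiv_pairs_trans E E'.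
Qed.

Lemma classified_form (A B P A' B' : 'M[K]_3) :
  normal_form A' B' -> \det P != 0 -> A *m P = P *m A' -> B *m P = P *m B' ->
  classified A B.
Proof.
by move=> N P0 EA EB; right; exists A', B'; split=> //; apply: equiv_pairsI EB.
Qed.

Lemma classified_conj (A B P A' B' : 'M[K]_3) :
  braid_pair A B ->
  \det P != 0 -> A *m P = P *m A' -> B *m P = P *m B' ->
  (braid_pair A' B' -> classified A' B') -> classified A B.
Proof.
move=> AB P0 EA EB H; have E := equiv_pairsI P0 EA EB.
exact: classified_equiv E (H (braid_pair_equiv AB E)).
Qed.

(** In the next three lemmas the line of e_1, e_2 or e_3 is a direct summand,
    the other two basis vectors spanning a complement. *)
Lemma classified_split1 (a b c d e a' b' c' d' e' : K) :
  classified (M3 a 0 0 0 b c 0 d e) (M3 a' 0 0 0 b' c' 0 d' e').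
Proof.
left; exists a, b, c, d, e, a', b', c', d', e'; exact: equiv_pairs_refl.
Qed.

Lemma classified_split2 (a b c d e a' b' c' d' e' : K) :
  classified (M3 b 0 c 0 a 0 d 0 e) (M3 b' 0 c' 0 a' 0 d' 0 e').
Proof.
apply: classified_equiv (classified_split1 a b c d e a' b' c' d' e').
apply: (equiv_pairsI (P := M3 0 1 0 1 0 0 0 0 1)).
- by rewrite det_mx3 (_ : _ + _ = -1) ?oppr_eq0 ?oner_eq0 //; ring.
- by rewrite !mx3_mul; apply: mx3_congr; ring.
- by rewrite !mx3_mul; apply: mx3_congr; ring.
Qed.

Lemma classified_split3 (a b c d e a' b' c' d' e' : K) :
  classified (M3 b c 0 d e 0 0 0 a) (M3 b' c' 0 d' e' 0 0 0 a').
Proof.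
apply: classified_equiv (classified_split1 a b c d e a' b' c' d' e').
apply: (equiv_pairsI (P := M3 0 1 0 0 0 1 1 0 0)).
- by rewrite det_mx3 (_ : _ + _ = 1) ?oner_eq0 //; ring.
- by rewrite !mx3_mul; apply: mx3_congr; ring.
- by rewrite !mx3_mul; apply: mx3_congr; ring.
Qed.

(** A change of basis that fixes the line of e_1 may be prescribed by its
    effect on A alone: the first column of B keeps its shape. *)
Lemma classified_flag (A A' : 'M[K]_3) (g h i a b c d : K) l v1 v2 p q r s :
  let B := M3 l v1 v2 0 p q 0 r s in
  let P := M3 g h i 0 a b 0 c d in
  braid_pair A B ->
  g != 0 -> a * d - b * c != 0 -> A *m P = P *m A' ->
  (forall l' v1' v2' p' q' r' s', let B' := M3 l' v1' v2' 0 p' q' 0 r' s' in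
     braid_pair A' B' -> classified A' B') ->
  classified A B.
Proof.
move=> B P AB g0 D0 EA H.
have P0 : \det P != 0.
  rewrite det_mx3 (_ : _ + _ = g * (a * d - b * c)) ?mulf_neq0 //; ring.
have uP : P \in unitmx by rewrite unitmxE unitfE.
have [B' EB] : exists B', B *m P = P *m B'.
  by exists (invmx P *m B *m P); rewrite !mulmxA mulmxV // mul1mx.
apply: (classified_conj AB P0 EA EB) => AB'.
have [z1 z2] : B' 1 0 = 0 /\ B' 2 0 = 0.
  have := EB; rewrite {1}(mx3_eta B') !mx3_mul.
  move=> /mx3_inj[_ [E1 _ _] [E2 _ _]].
  split; apply: (mulf_cancel0 D0).
    by apply: (lincomb2 (c1 := -d) (c2 := b) E1 E2); ring.
  by apply: (lincomb2 (c1 := c) (c2 := - a) E1 E2); ring.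
by move: AB'; rewrite (mx3_eta B') z1 z2; apply: H.
Qed.

(** * Primitive roots *)

(** In characteristic other than 2 and 3 the roots of X^2 - X + 1 are the
    primitive sixth roots of unity: their cube is -1, so their order divides 6
    but neither 2 nor 3. *)
Lemma prim6 (z : K) : (2 : K) != 0 -> (3 : K) != 0 ->
  z ^+ 2 - z + 1 = 0 -> 6.-primitive_root z.
Proof.
move=> two0 three0 z2.
have z3 : z ^+ 3 = -1 by apply: (lincomb1 (c1 := z + 1) z2); ring.
have z6 : z ^+ 6 = 1 by rewrite (exprM z 3 2) z3 sqrrN expr1n.
have [m zm] := prim_order_exists (isT : (0 < 6)%N) z6.
have m2 : (m %| 2)%N -> False.
  move=> /dvdnP[k mk]; have e2 : z ^+ 2 = 1.
    by rewrite mk mulnC exprM (prim_expr_order zm) expr1n.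
  have e : z = 2 by apply: (lincomb2 (c1 := -1) (c2 := 1) z2 e2); ring.
  move/eqP: three0; apply; move: e2; rewrite e => e2.
  by apply: (lincomb1 (c1 := 1) e2); ring.
have m3 : (m %| 3)%N -> False.
  move=> /dvdnP[k mk]; have e3 : z ^+ 3 = 1.
    by rewrite mk mulnC exprM (prim_expr_order zm) expr1n.
  move/eqP: two0; apply.
  by apply: (lincomb2 (c1 := -1) (c2 := 1) e3 z3); ring.
by case: m zm m2 m3 => [|[|[|[|[|[|[|m]]]]]]] // zm m2 m3;
   try (by case: m2); try (by case: m3).
Qed.

Lemma prim4 (z : K) : (2 : K) != 0 -> z ^+ 2 = - 1 -> 4.-primitive_root z.
Proof.
move=> two0 z2.
have z4 : z ^+ 4 = 1 by rewrite (exprM z 2 2) z2 sqrrN expr1n.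
have [m zm] := prim_order_exists (isT : (0 < 4)%N) z4.
have m2 : (m %| 2)%N -> False.
  move=> /dvdnP[k mk]; have e2 : z ^+ 2 = 1.
    by rewrite mk mulnC exprM (prim_expr_order zm) expr1n.
  move/eqP: two0; apply.
  by apply: (lincomb2 (c1 := -1) (c2 := 1) e2 z2); ring.
by case: m zm m2 => [|[|[|[|[|m]]]]] // zm m2; try (by case: m2).
Qed.

End BraidPairs.

(** * Entries of the quotient block *)

Section Cases.

Variable K : fieldType.
Hypotheses (two0 : (2 : K) != 0) (three0 : (3 : K) != 0).

Lemma distinct2 (a b : K) :
  a != 0 -> b != 0 -> a != b -> distinct_nonzero [:: a; b].
Proof.
move=> a0 b0 ab; split; first by rewrite /= inE ab.
by rewrite !inE !negb_or !(eq_sym 0) a0 b0.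
Qed.

Lemma distinct3 (a b c : K) :
  a != 0 -> b != 0 -> c != 0 -> a != b -> a != c -> b != c ->
  distinct_nonzero [:: a; b; c].
Proof.
move=> a0 b0 c0 ab ac bc; split; first by rewrite /= !inE negb_or ab ac bc.
by rewrite !inE !negb_or !(eq_sym 0) a0 b0 c0.
Qed.

(** Two distinct characters a and b of the braid group have a nonsplit
    extension only if a^2 - a b + b^2 = 0; their ratio is then a
    primitive sixth root of unity. *)
Lemma link_ratio (a b : K) :
  b != 0 -> a ^+ 2 - a * b + b ^+ 2 = 0 -> 6.-primitive_root (a / b).
Proof.
move=> b0 E; apply: prim6 => //; apply: (mulf_cancel0 (expf_neq0 2 b0)).
by apply: (lincomb1 (c1 := 1) E); field.
Qed.

(** If D = diag(a, b) and M is not diagonal, the diagonal entries of M are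
    determined; for a <> b this says p = b^2 / (b - a), s = a^2 / (a - b). *)
Lemma block_diag_entries (l u1 u2 a b v1 v2 p q r s : K) :
  braid_eqs l u1 u2 a 0 b v1 v2 p q r s -> q != 0 \/ r != 0 ->
  [/\ p * (a - b) = - b ^+ 2, s * (a - b) = a ^+ 2
    & a * p + b * s = a * b].
Proof.
case=> l0 a0 b0 T D E11 E12 E21 E22 _ _ qr.
have S : a * p + b * s = a * b.
  case: qr => z0; apply: (mulfI z0).
    by apply: (lincomb1 (c1 := -1) E12); ring.
  by apply: (lincomb1 (c1 := -1) E21); ring.
have P : p * (a - b) = - b ^+ 2.
  by apply: (lincomb2 (c1 := 1) (c2 := -b) S T); ring.
split=> //.
by apply: (lincomb2 (c1 := (a - b)) (c2 := -1) T P); ring.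
Qed.

Lemma block_diag_triv (l u1 u2 a b v1 v2 p q r s : K) :
  braid_eqs l u1 u2 a 0 b v1 v2 p q r s -> q * r = 0 -> p = a /\ s = b.
Proof.
case=> l0 a0 b0 T D E11 E12 E21 E22 _ _ qr.
have ps : p * s = a * b by apply: (lincomb2 (c1 := 1) (c2 := 1) D qr); ring.
have p0 : p != 0.
  apply/eqP=> p0; move: ps; rewrite p0 mul0r => /esym/eqP.
  by rewrite mulf_eq0 (negPf a0) (negPf b0).
have pa : p = a.
  apply: (mulfI (mulf_neq0 a0 p0)).
  by apply: (lincomb2 (c1 := -1) (c2 := - b) E11 qr); ring.
split=> //; apply: (mulfI p0); rewrite ps pa; ring.
Qed.

Lemma block_jordan_triv (l u1 u2 d v1 v2 p q s : K) :
  braid_eqs l u1 u2 d 1 d v1 v2 p q 0 s -> [/\ p = d, s = d & q = 1].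
Proof.
case=> l0 d0 _ T D _ E12 _ _ _ _.
have pd : p = d.
  apply/eqP; rewrite -subr_eq0 -sqrf_eq0; apply/eqP.
  by apply: (lincomb2 (c1 := p) (c2 := -1) T D); ring.
have sd : s = d.
  by apply: (lincomb2 (c1 := 1) (c2 := -1) T pd); ring.
split=> //; apply: (mulfI (expf_neq0 2 d0)).
rewrite {}pd {}sd in E12.
by apply: (lincomb1 (c1 := -1) E12); ring.
Qed.

(** If D is a Jordan block and r <> 0, one may assume p = d by adding a
    multiple of e_2 to e_3; then M is completely determined. *)
Lemma block_jordan_full (l u1 u2 d v1 v2 q r s : K) :
  braid_eqs l u1 u2 d 1 d v1 v2 d q r s -> r != 0 ->
  [/\ s = d, q = 0 & r = - d ^+ 2].
Proof.
case=> l0 d0 _ T D _ _ E21 _ _ _ r0.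
have sd : s = d by apply: (lincomb1 (c1 := 1) T); ring.
have q0 : q = 0.
  apply: (mulf_cancel0 r0).
  by rewrite {}sd in D; apply: (lincomb1 (c1 := -1) D); ring.
split=> //; apply: (mulfI r0); rewrite {}sd in E21.
by apply: (lincomb1 (c1 := -1) E21); ring.
Qed.

(** * Three distinct eigenvalues *)

Lemma classify_distinct_lower (l a b v1 v2 p q r s : K) :
  braid_pair (M3 l 0 0 0 a 0 0 0 b) (M3 l v1 v2 0 p q 0 r s) ->
  l != a -> l != b -> a != b -> r != 0 ->
  classified (M3 l 0 0 0 a 0 0 0 b) (M3 l v1 v2 0 p q 0 r s).
Proof.
move=> AB la lb ab r0.
have [_ E] := braid_pair_eqs AB.
have [Ep Es S] := block_diag_entries E (or_intror r0).
case: E => l0 a0 b0 T D _ _ _ _ E1 E2.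
have ab0 : a - b != 0 by rewrite subr_eq0.
have [v10|v10] := eqVneq v1 0.
  have v20 : v2 = 0.
    apply: (mulf_cancel0 (mulf_neq0 b0 r0)).
    by apply: (lincomb2 (c1 := -1) (c2 := l * a - l ^+ 2 - a * p) E1 v10);
       ring.
  by rewrite v10 v20; apply: classified_split1.
(* the determinant of D M - l D + l^2, which kills v, is the product
   (l^2 + a b) (l - a) (l - b) *)
have lab : l ^+ 2 + a * b = 0.
  have la0 : l - a != 0 by rewrite subr_eq0.
  have lb0 : l - b != 0 by rewrite subr_eq0.
  apply: (mulf_cancel0 v10); apply: (mulf_cancel0 la0).
  apply: (mulf_cancel0 lb0).
  have Q : q * r = p * s - a * b by rewrite -D; ring.
  have W : v1 * ((a * p - l * a + l ^+ 2) * (b * s - l * b + l ^+ 2)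
                 - a * b * (q * r)) = 0.
    by apply: (lincomb2 (c1 := - (b * s - l * b + l ^+ 2)) (c2 := b * r) E1 E2);
       ring.
  rewrite Q in W.
  by apply: (lincomb3 (c1 := 1) (c2 := - v1 * l ^+ 2) (c3 := v1 * l * a * b)
               W S T); ring.
have b_def : b = - (l ^+ 2 / a).
  by apply: (mulfI a0); apply: (lincomb1 (c1 := 1) lab); field.
have l2a2 : l ^+ 2 + a ^+ 2 != 0.
  apply: contraNneq ab0 => e; apply/eqP.
  apply: (mulf_cancel0 a0).
  by apply: (lincomb2 (c1 := 1) (c2 := -1) e lab); ring.
have ldist : distinct_nonzero [:: l; a; b] by apply: distinct3.
apply: (classified_form (P := M3 v1 0 0 0 1 0 0 0 r) (Form14 ldist b_def)).
- by rewrite det_mx3 (_ : _ + _ = v1 * r) ?mulf_neq0 //; ring.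
- by rewrite !mx3_mul; apply: mx3_congr; ring.
- have ab_l : a * (a - b) = l ^+ 2 + a ^+ 2.
    by apply: (lincomb1 (c1 := -1) lab); ring.
  have ab_e : a - b = (l ^+ 2 + a ^+ 2) / a.
    by apply: (mulfI a0); rewrite ab_l; field.
  have p_def : p = - l ^+ 4 / (a * (l ^+ 2 + a ^+ 2)).
    apply: (mulIf ab0); rewrite Ep ab_e b_def; field.
    by rewrite a0 l2a2.
  have s_def : s = a ^+ 3 / (l ^+ 2 + a ^+ 2).
    apply: (mulIf ab0); rewrite Es ab_e; field.
    by rewrite a0 l2a2.
  have q_def : r * q
      = l ^+ 2 * (l ^+ 4 + l ^+ 2 * a ^+ 2 + a ^+ 4) / (l ^+ 2 + a ^+ 2) ^+ 2.
    have -> : r * q = p * s - a * b by rewrite -D; ring.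
    rewrite p_def s_def b_def; field.
    by rewrite a0 l2a2.
  have v2_def : v2 * r = v1 * (- a ^+ 2 * (l ^+ 2 - l * a + a ^+ 2)
                     / (l * (l ^+ 2 + a ^+ 2))).
    apply: (mulfI b0).
    have -> : b * (v2 * r) = - v1 * (a * p - l * a + l ^+ 2).
      by apply: (lincomb1 (c1 := -1) E1); ring.
    rewrite p_def b_def; field.
    by rewrite a0 l2a2 l0.
  rewrite !mx3_mul; apply: mx3_congr;
    rewrite ?mul0r ?mulr0 ?addr0 ?add0r ?mulr1 ?mul1r //.
  + exact: mulrC.
  + by rewrite -q_def mulrC.
  + by rewrite -s_def mulrC.
Qed.

Lemma classify_distinct (l a b v1 v2 p q r s : K) :
  braid_pair (M3 l 0 0 0 a 0 0 0 b) (M3 l v1 v2 0 p q 0 r s) ->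
  l != a -> l != b -> a != b ->
  classified (M3 l 0 0 0 a 0 0 0 b) (M3 l v1 v2 0 p q 0 r s).
Proof.
move=> AB la lb ab.
have [r0|r0] := eqVneq r 0; last exact: classify_distinct_lower.
have [q0|q0] := eqVneq q 0; last first.
  (* exchanging e_2 and e_3 exchanges q and r *)
  apply: (classified_conj (P := M3 1 0 0 0 0 1 0 1 0)
    (A' := M3 l 0 0 0 b 0 0 0 a) (B' := M3 l v2 v1 0 s r 0 q p) AB).
  - by rewrite det_mx3 (_ : _ + _ = -1) ?oppr_eq0 ?oner_eq0 //; ring.
  - by rewrite !mx3_mul; apply: mx3_congr; ring.
  - by rewrite !mx3_mul; apply: mx3_congr; ring.
  - by move=> AB'; apply: classify_distinct_lower; rewrite // eq_sym.
have [_ E] := braid_pair_eqs AB.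
have qr : q * r = 0 by rewrite q0 mul0r.
have [pa sb] := block_diag_triv E qr.
case: E => l0 a0 b0 _ _ _ _ _ _ E1 E2.
rewrite {}q0 {}r0 {}pa {}sb in AB E1 E2 *.
have [v10|v10] := eqVneq v1 0; first by rewrite v10; apply: classified_split2.
have [v20|v20] := eqVneq v2 0; first by rewrite v20; apply: classified_split3.
have La : a ^+ 2 - a * l + l ^+ 2 = 0.
  apply: (mulf_cancel0 v10).
  by apply: (lincomb1 (c1 := -1) E1); ring.
have Lb : b ^+ 2 - b * l + l ^+ 2 = 0.
  apply: (mulf_cancel0 v20).
  by apply: (lincomb1 (c1 := -1) E2); ring.
have abl : a + b = l.
  have ab0 : a - b != 0 by rewrite subr_eq0.
  by apply: (mulfI ab0); apply: (lincomb2 (c1 := 1) (c2 := -1) La Lb); ring.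
have a_def : a = l * (a / l) by field.
have b_def : b = l * (a / l)^-1.
  apply: (mulfI a0); rewrite (_ : a * (l * _) = l ^+ 2); last first.
    by field; rewrite a0 l0.
  by apply: (lincomb2 (c1 := a) (c2 := -1) abl La); ring.
apply: (classified_form (P := M3 1 0 0 0 v1^-1 0 0 0 v2^-1)
  (Form11 (distinct3 l0 a0 b0 la lb ab) (link_ratio l0 La) a_def b_def)).
- rewrite det_mx3 (_ : _ + _ = v1^-1 * v2^-1); last by ring.
  by rewrite mulf_neq0 ?invr_eq0.
- by rewrite !mx3_mul; apply: mx3_congr; ring.
- by rewrite !mx3_mul; apply: mx3_congr; field; rewrite ?v10 ?v20.
Qed.

(** * A repeated eigenvalue *)

(** The two first rows are multiples of one vector (w1, w2), so some
    combination of e_2 and e_3 spans a direct summand. *)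
Lemma classify_scalar_prop (l d f g w1 w2 : K) :
  classified (M3 l (f * w1) (f * w2) 0 d 0 0 0 d)
             (M3 l (g * w1) (g * w2) 0 d 0 0 0 d).
Proof.
have [w10|w10] := eqVneq w1 0.
  by rewrite w10 !mulr0; apply: classified_split2.
apply: classified_equiv (classified_split3 d l (f * w1) 0 d d l (g * w1) 0 d).
apply: (equiv_pairsI (P := M3 1 0 0 0 1 (- w2) 0 0 w1)).
- by rewrite det_mx3 (_ : _ + _ = w1) //; ring.
- by rewrite !mx3_mul; apply: mx3_congr; ring.
- by rewrite !mx3_mul; apply: mx3_congr; ring.
Qed.

Lemma classify_scalar (l u1 u2 d v1 v2 p q r s : K) :
  braid_pair (M3 l u1 u2 0 d 0 0 0 d) (M3 l v1 v2 0 p q 0 r s) ->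
  classified (M3 l u1 u2 0 d 0 0 0 d) (M3 l v1 v2 0 p q 0 r s).
Proof.
move=> AB; have [_ E] := braid_pair_eqs AB.
have [q0 r0] : q = 0 /\ r = 0.
  have d0 := be_a E.
  split; apply: (mulf_cancel0 (expf_neq0 2 d0)).
    by apply: (lincomb2 (c1 := -1) (c2 := -d * q) (be_12 E) (be_tr E)); ring.
  by apply: (lincomb2 (c1 := -1) (c2 := -d * r) (be_21 E) (be_tr E)); ring.
have qr : q * r = 0 by rewrite q0 mul0r.
have [pd sd] := block_diag_triv E qr.
case: E => l0 d0 _ _ _ _ _ _ _ E1 E2.
rewrite {}q0 {}r0 {}pd {}sd in AB E1 E2 *.
have [ld|ld] := eqVneq l d.
  subst d.
  have -> : u1 = v1.
    apply: (mulfI (expf_neq0 2 l0)).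
    by apply: (lincomb1 (c1 := 1) E1); ring.
  have -> : u2 = v2.
    apply: (mulfI (expf_neq0 2 l0)).
    by apply: (lincomb1 (c1 := 1) E2); ring.
  by have := classify_scalar_prop l l 1 1 v1 v2; rewrite !mul1r.
have dl0 : d - l != 0 by rewrite subr_eq0 eq_sym.
apply: (classified_equiv
  (A' := M3 l (0 * (v1 - u1)) (0 * (v2 - u2)) 0 d 0 0 0 d)
  (B' := M3 l (1 * (v1 - u1)) (1 * (v2 - u2)) 0 d 0 0 0 d)); last first.
  exact: classify_scalar_prop.
apply: (equiv_pairsI (P := M3 1 (u1 / (d - l)) (u2 / (d - l)) 0 1 0 0 0 1)).
- by rewrite det_mx3 (_ : _ + _ = 1) ?oner_eq0 //; ring.
- by rewrite !mx3_mul; apply: mx3_congr; field.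
- by rewrite !mx3_mul; apply: mx3_congr; field.
Qed.

Lemma classify_jordan_top_lower (l d v1 v2 q r s : K) :
  braid_pair (M3 l 0 0 0 d 1 0 0 d) (M3 l v1 v2 0 d q 0 r s) ->
  l != d -> r != 0 ->
  classified (M3 l 0 0 0 d 1 0 0 d) (M3 l v1 v2 0 d q 0 r s).
Proof.
move=> AB ld r0; have [_ E] := braid_pair_eqs AB.
have [sd q0 rd] := block_jordan_full E r0.
case: E => l0 d0 _ _ _ _ _ _ _ E1 E2.
rewrite {}q0 {}sd {}rd in AB E1 E2 *.
have [v10|v10] := eqVneq v1 0.
  have v20 : v2 = 0.
    apply: (mulf_cancel0 (expf_neq0 3 d0)).
    by rewrite {}v10 in E1; apply: (lincomb1 (c1 := 1) E1); ring.
  by rewrite v10 v20; apply: classified_split1.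
have ld0 : l - d != 0 by rewrite subr_eq0.
have l2 : l ^+ 2 = - d ^+ 2.
  apply/eqP; rewrite -subr_eq0; apply/eqP.
  apply: (mulf_cancel0 v10); apply: (mulf_cancel0 ld0).
  apply: (mulf_cancel0 ld0).
  by apply: (lincomb2 (c1 := - (d ^+ 2 - l * d + l ^+ 2)) (c2 := - d ^+ 3)
               E1 E2); ring.
have v2_def : v2 = v1 * ((l + d) / l ^+ 2).
  apply: (mulfI (expf_neq0 2 l0)).
  rewrite [RHS](_ : _ = v1 * (l + d)); last by field.
  apply: (mulfI d0).
  by apply: (lincomb2 (c1 := -1) (c2 := v2 * d - v1) E1 l2); ring.
have z2 : (d / l) ^+ 2 = -1.
  apply: (mulfI (expf_neq0 2 l0)).
  by apply: (lincomb1 (c1 := 1) l2); field.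
have d_def : d = l * (d / l) by field.
apply: (classified_form (P := M3 v1 0 0 0 1 0 0 0 1)
  (Form32 (distinct2 l0 d0 ld) (prim4 two0 z2) d_def)).
- by rewrite det_mx3 (_ : _ + _ = v1) //; ring.
- by rewrite !mx3_mul; apply: mx3_congr; ring.
- rewrite v2_def -l2 !mx3_mul; apply: mx3_congr; ring.
Qed.

Lemma classify_jordan_top (l d v1 v2 p q r s : K) :
  braid_pair (M3 l 0 0 0 d 1 0 0 d) (M3 l v1 v2 0 p q 0 r s) ->
  l != d ->
  classified (M3 l 0 0 0 d 1 0 0 d) (M3 l v1 v2 0 p q 0 r s).
Proof.
move=> AB ld; have [r0|r0] := eqVneq r 0; last first.
  (* replacing e_3 by e_3 + c e_2 commutes with A and makes p equal to d *)
  pose c := (p - d) / r.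
  have pc : p = d + c * r by rewrite /c; field.
  apply: (classified_conj (P := M3 1 0 0 0 1 c 0 0 1)
    (A' := M3 l 0 0 0 d 1 0 0 d)
    (B' := M3 l v1 (v2 + c * v1) 0 d (c * p + q - c * (c * r + s))
              0 r (c * r + s)) AB).
  - by rewrite det_mx3 (_ : _ + _ = 1) ?oner_eq0 //; ring.
  - by rewrite !mx3_mul; apply: mx3_congr; ring.
  - by rewrite pc !mx3_mul; apply: mx3_congr; ring.
  - by move=> AB'; apply: classify_jordan_top_lower.
have [_ E] := braid_pair_eqs AB.
rewrite {}r0 in AB E *.
have [pd sd q1] := block_jordan_triv E.
case: E => l0 d0 _ _ _ _ _ _ _ E1 E2.
rewrite {}pd {}sd {}q1 in AB E1 E2 *.
(* if v1 <> 0, then l is a root of both d^2 - l d + l^2 and 2 d - l,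
   so that 3 d^2 = 0 *)
have v10 : v1 = 0.
  apply/eqP/negP=> /negP v10.
  have f0 : d ^+ 2 - l * d + l ^+ 2 = 0.
    by apply: (mulf_cancel0 v10); apply: (lincomb1 (c1 := -1) E1); ring.
  have l2d : l = 2 * d.
    apply: (mulfI v10).
    by apply: (lincomb2 (c1 := 1) (c2 := v2) E2 f0); ring.
  have /eqP : 3 * d ^+ 2 = 0 by rewrite -[RHS]f0 l2d; ring.
  by rewrite mulf_eq0 (negPf three0) expf_eq0 (negPf d0).
clear E1; rewrite {}v10 in AB E2 *.
have [v20|v20] := eqVneq v2 0; first by rewrite v20; apply: classified_split1.
have f0 : l ^+ 2 - l * d + d ^+ 2 = 0.
  by apply: (mulf_cancel0 v20); apply: (lincomb1 (c1 := -1) E2); ring.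
have l_def : l = d * (l / d) by field.
apply: (classified_form (P := M3 v2 0 0 0 1 0 0 0 1)
  (Form31 (distinct2 l0 d0 ld) (link_ratio d0 f0) l_def)).
- by rewrite det_mx3 (_ : _ + _ = v2) //; ring.
- by rewrite !mx3_mul; apply: mx3_congr; ring.
- by rewrite !mx3_mul; apply: mx3_congr; ring.
Qed.

Lemma classify_double_upper (l t b v1 p q r s : K) :
  braid_pair (M3 l t 0 0 l 0 0 0 b) (M3 l v1 0 0 p q 0 r s) ->
  l != b -> q != 0 ->
  classified (M3 l t 0 0 l 0 0 0 b) (M3 l v1 0 0 p q 0 r s).
Proof.
move=> AB lb q0; have [_ E] := braid_pair_eqs AB.
have [Ep Es S] := block_diag_entries E (or_introl q0).
case: E => l0 _ b0 T D _ _ _ _ E1 E2.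
have lb0 : l - b != 0 by rewrite subr_eq0.
have p0 : p != 0.
  apply: contraNneq b0 => p0; rewrite -sqrf_eq0 -oppr_eq0 -Ep p0 mul0r //.
have [t0|t0] := eqVneq t 0.
  have -> : v1 = 0.
    apply: (mulf_cancel0 (mulf_neq0 l0 p0)).
    by rewrite {}t0 in E1; apply: (lincomb1 (c1 := -1) E1); ring.
  by rewrite t0; apply: classified_split1.
have v1_l : l * v1 = t * (b - l).
  by apply: (mulfI q0); apply: (lincomb1 (c1 := -1) E2); ring.
have l_def : l = - b.
  apply: (mulfI lb0); apply: (mulfI t0).
  by apply: (lincomb3 (c1 := 1) (c2 := p) (c3 := - t) E1 v1_l Ep); ring.
have four0 : (4 : K) != 0.
  by rewrite (_ : 4 = 2 * 2) ?mulf_neq0 //; ring.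
have v1_def : v1 = t * - 2.
  apply: (mulfI l0).
  by apply: (lincomb2 (c1 := 1) (c2 := t) v1_l l_def); ring.
have p_def : p = b / 2.
  by apply: (mulfI lb0); rewrite mulrC Ep l_def; field; rewrite ?two0.
have s_def : s = - (b / 2).
  by rewrite -p_def; apply: (lincomb2 (c1 := 1) (c2 := 1) T l_def); ring.
have r_def : r = 3 * b ^+ 2 / 4 / q.
  apply: (mulfI q0).
  rewrite [LHS](_ : _ = p * s - l * b); last by rewrite -D; ring.
  by rewrite p_def s_def l_def; field; rewrite q0 four0 two0.
apply: (classified_form (P := M3 t 0 0 0 1 0 0 0 q^-1)
  (Form42 (distinct2 l0 b0 lb) l_def)).
- rewrite det_mx3 (_ : _ + _ = t * q^-1); last by ring.
  by rewrite mulf_neq0 ?invr_eq0.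
- by rewrite !mx3_mul; apply: mx3_congr; ring.
- rewrite v1_def p_def s_def r_def !mx3_mul.
  by apply: mx3_congr; field; rewrite ?q0 ?four0 ?two0.
Qed.

Lemma classify_double (l t b v1 v2 p q r s : K) :
  braid_pair (M3 l t 0 0 l 0 0 0 b) (M3 l v1 v2 0 p q 0 r s) ->
  l != b ->
  classified (M3 l t 0 0 l 0 0 0 b) (M3 l v1 v2 0 p q 0 r s).
Proof.
move=> AB lb; have [q0|q0] := eqVneq q 0; last first.
  (* replacing e_2 by e_2 + c e_1 commutes with A and kills v2 *)
  pose c := v2 / q.
  have v2_def : v2 = c * q by rewrite /c; field.
  apply: (classified_conj (P := M3 1 c 0 0 1 0 0 0 1)
    (A' := M3 l t 0 0 l 0 0 0 b)
    (B' := M3 l (c * l + v1 - c * p) 0 0 p q 0 r s) AB).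
  - by rewrite det_mx3 (_ : _ + _ = 1) ?oner_eq0 //; ring.
  - by rewrite !mx3_mul; apply: mx3_congr; ring.
  - by rewrite v2_def !mx3_mul; apply: mx3_congr; ring.
  - by move=> AB'; apply: classify_double_upper.
have [_ E] := braid_pair_eqs AB.
have qr : q * r = 0 by rewrite q0 mul0r.
have [pl sb] := block_diag_triv E qr.
case: E => l0 _ b0 _ _ _ _ E21 _ E1 E2.
clear qr; rewrite {}q0 {}pl {}sb in AB E1 E2 E21 *.
have [v20|v20] := eqVneq v2 0.
  have v1t : v1 = t.
    apply: (mulfI (expf_neq0 2 l0)).
    by rewrite {}v20 in E1; apply: (lincomb1 (c1 := -1) E1); ring.
  clear E1 E2; rewrite v20 {}v1t in AB *.
  have [r0|r0] := eqVneq r 0; first by rewrite r0; apply: classified_split3.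
  have [t0|t0] := eqVneq t 0; first by rewrite t0; apply: classified_split1.
  have f0 : b ^+ 2 - b * l + l ^+ 2 = 0.
    by apply: (mulf_cancel0 r0); apply: (lincomb1 (c1 := -1) E21); ring.
  have b_def : b = l * (b / l) by field.
  have bl : b != l by rewrite eq_sym.
  (* e_3 spans an invariant line *)
  apply: (classified_form (P := M3 0 t 0 0 0 1 r 0 0)
    (Form31 (distinct2 b0 l0 bl) (link_ratio l0 f0) b_def)).
  - by rewrite det_mx3 (_ : _ + _ = t * r) ?mulf_neq0 //; ring.
  - by rewrite !mx3_mul; apply: mx3_congr; ring.
  - by rewrite !mx3_mul; apply: mx3_congr; ring.
have f0 : l ^+ 2 - l * b + b ^+ 2 = 0.
  by apply: (mulf_cancel0 v20); apply: (lincomb1 (c1 := -1) E2); ring.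
have l_def : l = b * (l / b) by field.
have v1_l : v1 * l ^+ 2 = t * l ^+ 2 - v2 * r * b.
  by apply: (lincomb1 (c1 := -1) E1); ring.
have [t0|t0] := eqVneq t 0; last first.
  pose beta := r * v2 / t.
  apply: (classified_form (P := M3 t 0 0 0 1 0 0 0 (t / v2))
    (Form41 beta (distinct2 l0 b0 lb) (link_ratio b0 f0) l_def)).
  - rewrite det_mx3 (_ : _ + _ = t * (t / v2)); last by ring.
    by rewrite !mulf_neq0 ?invr_eq0.
  - by rewrite !mx3_mul; apply: mx3_congr; ring.
  - have v1_def : v1 = t * (1 + l * beta / b ^+ 2).
      have -> : t * (1 + l * beta / b ^+ 2) = t + l * r * v2 / b ^+ 2.
        by rewrite /beta; field; rewrite b0.
      apply: (mulIf (expf_neq0 2 l0)); apply: (mulIf (expf_neq0 2 b0)).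
      rewrite [RHS](_ : _ = t * l ^+ 2 * b ^+ 2 + l ^+ 3 * r * v2);
        last by field.
      by apply: (lincomb2 (c1 := b ^+ 2) (c2 := - v2 * r * (l + b))
                   v1_l f0); ring.
    by rewrite {}v1_def !mx3_mul /beta; apply: mx3_congr; field;
       rewrite ?v20 ?t0 ?b0.
rewrite {}t0 in AB E1 v1_l *.
have [r0|r0] := eqVneq r 0.
  have -> : v1 = 0.
    apply: (mulf_cancel0 (expf_neq0 2 l0)).
    by apply: (lincomb2 (c1 := 1) (c2 := - v2 * b) v1_l r0); ring.
  by rewrite r0; apply: classified_split2.
have v10 : v1 != 0.
  apply/negP=> /eqP e; have /eqP : v2 * r * b = 0.
    by apply: (lincomb2 (c1 := 1) (c2 := - l ^+ 2) v1_l e); ring.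
  by rewrite !mulf_eq0 (negPf v20) (negPf r0) (negPf b0).
have lb0 : l - b != 0 by rewrite subr_eq0.
have bl0 : b - l != 0 by rewrite subr_eq0 eq_sym.
apply: (classified_form (P := M3 v1 0 0 0 1 0 0 0 r)
  (Form2 (distinct2 l0 b0 lb) (link_ratio b0 f0) l_def)).
- by rewrite det_mx3 (_ : _ + _ = v1 * r) ?mulf_neq0 //; ring.
- by rewrite !mx3_mul; apply: mx3_congr; ring.
- have -> : b ^+ 2 / (b - l) = l.
    apply: (mulIf bl0); rewrite [LHS](_ : _ = b ^+ 2); last by field.
    by apply: (lincomb1 (c1 := 1) f0); ring.
  have -> : l ^+ 2 / (l - b) = b.
    apply: (mulIf lb0); rewrite [LHS](_ : _ = l ^+ 2); last by field.
    by apply: (lincomb1 (c1 := 1) f0); ring.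
  have v2_def : v2 * r = v1 * (l * b / (l - b)).
    apply: (mulIf lb0); rewrite [RHS](_ : _ = v1 * (l * b)); last by field.
    apply: (mulIf b0); apply: (mulIf (expf_neq0 2 l0)).
    by apply: (lincomb2 (c1 := - b ^+ 2 * l) (c2 := v2 * r * b * l) v1_l f0);
       ring.
  by rewrite !mx3_mul; apply: mx3_congr;
     rewrite ?mul0r ?mulr0 ?addr0 ?add0r ?v2_def; ring.
Qed.

Lemma classify_triple_lower (l u v2 q r s : K) :
  braid_pair (M3 l u 0 0 l 1 0 0 l) (M3 l 0 v2 0 l q 0 r s) -> r != 0 ->
  classified (M3 l u 0 0 l 1 0 0 l) (M3 l 0 v2 0 l q 0 r s).
Proof.
move=> AB r0; have [_ E] := braid_pair_eqs AB.
have [sl q0 rl] := block_jordan_full E r0.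
case: E => l0 _ _ _ _ _ _ _ _ E1 E2.
rewrite {}q0 {}sl {}rl in AB E1 E2 *.
have Eu : u = - l * v2.
  apply: (mulfI (expf_neq0 2 l0)).
  by apply: (lincomb1 (c1 := 1) E1); ring.
have v20 : v2 = 0.
  apply: (mulf_cancel0 (mulf_neq0 two0 (expf_neq0 2 l0))).
  by apply: (lincomb2 (c1 := -1) (c2 := l) E2 Eu); ring.
by rewrite Eu v20 mulr0; apply: classified_split1.
Qed.

Lemma classify_triple (l u v1 v2 p q r s : K) :
  braid_pair (M3 l u 0 0 l 1 0 0 l) (M3 l v1 v2 0 p q 0 r s) ->
  classified (M3 l u 0 0 l 1 0 0 l) (M3 l v1 v2 0 p q 0 r s).
Proof.
move=> AB; have [r0|r0] := eqVneq r 0; last first.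
  (* this base change commutes with A for all c and e, which are chosen to
     make p equal to l and v1 equal to 0 *)
  pose c := (p - l) / r.
  have pc : p = l + c * r by rewrite /c; field.
  pose e := c ^+ 2 * u + (l * c * u + v1 - c * u * p) / r.
  have v1_def : v1 = (e - c ^+ 2 * u) * r - l * c * u + c * u * p.
    by rewrite /e; field.
  apply: (classified_conj (P := M3 1 (c * u) e 0 1 c 0 0 1)
    (A' := M3 l u 0 0 l 1 0 0 l)
    (B' := M3 l 0 (l * e + v1 * c + v2 - c * u * (p * c + q)
                   + (c ^+ 2 * u - e) * (r * c + s))
              0 l (p * c + q - c * (r * c + s)) 0 r (r * c + s)) AB).
  - by rewrite det_mx3 (_ : _ + _ = 1) ?oner_eq0 //; ring.
  - by rewrite !mx3_mul; apply: mx3_congr; ring.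
  - rewrite !mx3_mul; apply: mx3_congr; try ring; last by rewrite pc; ring.
    by rewrite v1_def pc; ring.
  - by move=> AB'; apply: classify_triple_lower.
have [_ E] := braid_pair_eqs AB.
rewrite {}r0 in AB E *.
have [pl sl q1] := block_jordan_triv E.
case: E => l0 _ _ _ _ _ _ _ _ E1 E2.
rewrite {}pl {}sl {}q1 in AB E1 E2 *.
have v1u : v1 = u.
  apply: (mulfI (expf_neq0 2 l0)).
  by apply: (lincomb1 (c1 := -1) E1); ring.
clear E1; rewrite v1u in AB E2 *.
have v20 : v2 = 0.
  apply: (mulf_cancel0 (expf_neq0 2 l0)).
  by apply: (lincomb1 (c1 := -1) E2); ring.
rewrite v20.
have [u0|u0] := eqVneq u 0; first by rewrite u0; apply: classified_split1.
apply: (classified_form (P := M3 u 0 0 0 1 0 0 0 1) (Form5 l0)).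
- by rewrite det_mx3 (_ : _ + _ = u) //; ring.
- by rewrite !mx3_mul; apply: mx3_congr; ring.
- by rewrite !mx3_mul; apply: mx3_congr; ring.
Qed.

End Cases.

(** * Reduction to the five shapes of the first matrix *)

Section Reduction.

Variable K : fieldType.
Hypotheses (two0 : (2 : K) != 0) (three0 : (3 : K) != 0).

(** The columns of each base change are eigenvectors, or Jordan chains, of A
    adapted to the flag; 1 / (a - l), 1 / (b - l) and 1 / (b - a) come from
    solving for their coordinates. *)
Lemma classify_triangular (l u1 u2 a x b l' v1 v2 p q r s : K) :
  let A := M3 l u1 u2 0 a x 0 0 b in
  let B := M3 l' v1 v2 0 p q 0 r s in
  braid_pair A B -> classified A B.
Proof.
move=> A B AB; have [El' _] := braid_pair_eqs AB; rewrite /A /B in AB *.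
rewrite {A B}El' in AB *.
have [ab|ab] := eqVneq a b.
  subst b.
  have [x0|x0] := eqVneq x 0.
    by rewrite x0 in AB *; apply: classify_scalar AB.
  have det2 : x * 1 - 0 * 0 != 0 by rewrite mulr1 mul0r subr0.
  have [la|la] := eqVneq l a.
    subst a.
    apply: (classified_flag (A' := M3 l (u1 * x) 0 0 l 1 0 0 l)
              (h := u2) (i := 0) AB (oner_neq0 _) det2).
      by rewrite !mx3_mul; apply: mx3_congr; ring.
    move=> m {}v1 {}v2 {}p {}q {}r {}s B {}AB.
    have [Em _] := braid_pair_eqs AB; rewrite /B Em in AB *.
    exact: classify_triple.
  have al : a - l != 0 by rewrite subr_eq0 eq_sym.
  apply: (classified_flag (A' := M3 l 0 0 0 a 1 0 0 a)
            (h := u1 * x / (a - l)) (i := (u2 - u1 * x / (a - l)) / (a - l))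
            AB (oner_neq0 _) det2).
    by rewrite !mx3_mul; apply: mx3_congr; field.
  move=> m {}v1 {}v2 {}p {}q {}r {}s B {}AB.
  have [Em _] := braid_pair_eqs AB; rewrite /B Em in AB *.
  exact: classify_jordan_top.
have ba0 : b - a != 0 by rewrite subr_eq0 eq_sym.
have [lb|lb] := eqVneq l b.
  (* the eigenvector of D for l = b becomes the second basis vector *)
  subst b.
  have al : a - l != 0 by rewrite subr_eq0.
  have det2 : x / (l - a) * 0 - 1 * 1 != 0.
    by rewrite mulr0 mul1r sub0r oppr_eq0 oner_neq0.
  apply: (classified_flag (A' := M3 l (u1 * (x / (l - a)) + u2) 0 0 l 0 0 0 a)
            (h := 0) (i := u1 / (a - l)) AB (oner_neq0 _) det2).
    by rewrite !mx3_mul; apply: mx3_congr; field; rewrite ?ba0 ?al.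
  move=> m {}v1 {}v2 {}p {}q {}r {}s B {}AB.
  have [Em _] := braid_pair_eqs AB; rewrite /B Em in AB *.
  by apply: classify_double; rewrite // eq_sym.
have bl : b - l != 0 by rewrite subr_eq0 eq_sym.
have det2 : 1 * 1 - x / (b - a) * 0 != 0 by rewrite mulr0 mulr1 subr0 oner_neq0.
pose i := (u1 * (x / (b - a)) + u2) / (b - l).
have [la|la] := eqVneq l a.
  subst a.
  apply: (classified_flag (A' := M3 l u1 0 0 l 0 0 0 b)
            (h := 0) (i := i) AB (oner_neq0 _) det2).
    by rewrite /i !mx3_mul; apply: mx3_congr; field; rewrite ?ba0 ?bl.
  move=> m {}v1 {}v2 {}p {}q {}r {}s B {}AB.
  have [Em _] := braid_pair_eqs AB; rewrite /B Em in AB *.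
  exact: classify_double.
have al : a - l != 0 by rewrite subr_eq0 eq_sym.
apply: (classified_flag (A' := M3 l 0 0 0 a 0 0 0 b)
          (h := u1 / (a - l)) (i := i) AB (oner_neq0 _) det2).
  by rewrite /i !mx3_mul; apply: mx3_congr; field; rewrite ?ba0 ?bl ?al.
move=> m {}v1 {}v2 {}p {}q {}r {}s B {}AB.
have [Em _] := braid_pair_eqs AB; rewrite /B Em in AB *.
exact: classify_distinct.
Qed.

End Reduction.

(** * Pairs with a common eigenvector *)

Section Reducible.

Variable K : closedFieldType.
Hypotheses (two0 : (2 : K) != 0) (three0 : (3 : K) != 0).

Lemma quadratic_root (a b c : K) : a != 0 ->
  exists y, a * y ^+ 2 + b * y + c = 0.
Proof.
move=> a0.
have [y Ey] := solve_monicpoly (fun i => if i == 0%N then - c / a else - b / a)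
                 (isT : (0 < 2)%N).
exists y; rewrite Ey !big_ord_recl big_ord0 /=; field.
exact: a0.
Qed.

Lemma classify_flag (l u1 u2 a x c b l' v1 v2 p q r s : K) :
  let A := M3 l u1 u2 0 a x 0 c b in
  let B := M3 l' v1 v2 0 p q 0 r s in
  braid_pair A B -> classified A B.
Proof.
move=> A B AB; rewrite /A /B in AB *.
have [c0|c0] := eqVneq c 0.
  by rewrite c0 in AB *; apply: classify_triangular.
have [y Ey] := quadratic_root (b - a) (- x) c0.
(* (y, 1) is an eigenvector of the block of A, with eigenvalue c * y + b *)
have det2 : y * 0 - 1 * 1 != 0.
  by rewrite mulr0 mul1r sub0r oppr_eq0 oner_neq0.
apply: (classified_flag
          (A' := M3 l (u1 * y + u2) u1 0 (c * y + b) c 0 0 (a - y * c))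
          (h := 0) (i := 0) AB (oner_neq0 _) det2); last first.
  by move=> *; apply: classify_triangular.
rewrite !mx3_mul; apply: mx3_congr; try ring.
by apply: (lincomb1 (c1 := -1) Ey); ring.
Qed.

Lemma col0_completion (w : 'cV[K]_3) :
  w != 0 -> exists2 P : 'M[K]_3, P \in unitmx & col 0 P = w.
Proof.
have Ew b c e f h i :
    col 0 (M3 (w 0 0) b c (w 1 0) e f (w 2 0) h i) = w.
  apply/matrixP=> k j; rewrite !mxE ord1.
  by case: k => [[|[|[|//]]] ?] /=; congr (w _ _); apply: val_inj.
have [w1|w1] := eqVneq (w 0 0) 0; last first.
  move=> _; exists (M3 (w 0 0) 0 0 (w 1 0) 1 0 (w 2 0) 0 1); last exact: Ew.
  by rewrite unitmxE unitfE det_mx3 (_ : _ + _ = w 0 0) //; ring.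
have [w2|w2] := eqVneq (w 1 0) 0; last first.
  move=> _; exists (M3 (w 0 0) 1 0 (w 1 0) 0 0 (w 2 0) 0 1); last exact: Ew.
  rewrite unitmxE unitfE det_mx3 (_ : _ + _ = - w 1 0) ?oppr_eq0 //; ring.
move=> w0; exists (M3 (w 0 0) 1 0 (w 1 0) 0 1 (w 2 0) 0 0); last exact: Ew.
rewrite unitmxE unitfE det_mx3 (_ : _ + _ = w 2 0); last by ring.
apply: contraNneq w0 => w3; apply/eqP/matrixP=> k j; rewrite !mxE ord1.
case: k => [[|[|[|//]]] k3]; [rewrite -w1|rewrite -w2|rewrite -[RHS]w3];
  congr (w _ _); exact: val_inj.
Qed.

Lemma classify_common_eigenvector (A B : 'M[K]_3) (w : 'cV[K]_3) (l l' : K) :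
  braid_pair A B -> w != 0 -> A *m w = l *: w -> B *m w = l' *: w ->
  classified A B.
Proof.
move=> AB w0 Aw Bw.
have [P uP Pw] := col0_completion w0.
have conj X m : X *m w = m *: w ->
    exists b c d e f g,
      invmx P *m X *m P = M3 m b c 0 d e 0 f g.
  move=> Xw; pose Y := invmx P *m X *m P.
  have Y0 : col 0 Y = m *: delta_mx 0 0.
    rewrite colE /Y -!mulmxA -colE Pw Xw -scalemxAr -Pw colE mulmxA.
    by rewrite mulVmx // mul1mx.
  exists (Y 0 1), (Y 0 2), (Y 1 1), (Y 1 2), (Y 2 1), (Y 2 2).
  have Y0i i : Y i 0 = m *+ (i == 0).
    by have /matrixP/(_ i 0) := Y0; rewrite !mxE eqxx andbT mulr_natr.
  by rewrite -/Y {1}(mx3_eta Y) !Y0i.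
have [u1 [u2 [a [x [c [b EA]]]]]] := conj A l Aw.
have [v1 [v2 [p [q [r [s EB]]]]]] := conj B l' Bw.
have E : equivalent_pairs A B (M3 l u1 u2 0 a x 0 c b)
                            (M3 l' v1 v2 0 p q 0 r s).
  by exists P; rewrite ?EA ?EB.
apply: (classified_equiv E); apply: classify_flag.
exact: braid_pair_equiv AB E.
Qed.

End Reducible.

(** * Coordinates in a basis of the representation space *)

Section Coordinates.

Variables (K : fieldType) (V : vectType K) (n : nat).
Variables (e : n.-tuple V) (e_basis : basis_of {:V} e).

Local Notation mat := (matrix_in_basis e).

(** The vector whose coordinates in the family e are the entries of x. *)
Definition vec_of_col (x : 'cV[K]_n) : V := \sum_i x i 0 *: e`_i.

Lemma vec_of_col_linear : linear vec_of_col.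
Proof.
move=> k x y; rewrite /vec_of_col scaler_sumr -big_split /=.
by apply: eq_bigr => i _; rewrite !mxE scalerDl scalerA.
Qed.

HB.instance Definition _ :=
  GRing.isLinear.Build K 'cV[K]_n V *:%R vec_of_col vec_of_col_linear.

Lemma coord_vec_of_col (x : 'cV[K]_n) i : coord e i (vec_of_col x) = x i 0.
Proof. by rewrite coord_sum_free // (basis_free e_basis). Qed.

Lemma vec_of_col_inj : injective vec_of_col.
Proof.
move=> x y E; apply/colP=> i.
by rewrite -[LHS]coord_vec_of_col E coord_vec_of_col.
Qed.

Lemma vec_of_coords (v : V) : vec_of_col (\col_i coord e i v) = v.
Proof.
rewrite [RHS](coord_basis e_basis (memvf v)).
by apply: eq_bigr => i _; rewrite mxE.
Qed.

Lemma matrix_in_basisE (f : 'End(V)) (x : 'cV[K]_n) :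
  f (vec_of_col x) = vec_of_col (mat f *m x).
Proof.
rewrite -[LHS]vec_of_coords; congr vec_of_col; apply/colP=> i; rewrite !mxE.
rewrite /vec_of_col !linear_sum; apply: eq_bigr => j _.
by rewrite !linearZ mxE /= mulrC.
Qed.

Lemma matrix_in_basis_comp (f g : 'End(V)) : mat (f \o g)%VF = mat f *m mat g.
Proof.
apply/matrixP=> i j; rewrite !mxE lfunE /=.
rewrite {1}(coord_basis e_basis (memvf (g e`_j))) !linear_sum.
by apply: eq_bigr => k _; rewrite !linearZ !mxE /= mulrC.
Qed.

Lemma matrix_in_basis_id : mat \1%VF = 1%:M.
Proof.
apply/matrixP=> i j; rewrite !mxE id_lfunE.
rewrite (coord_free _ _ (basis_free e_basis)).
by rewrite eq_sym.
Qed.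

End Coordinates.

(** * From representations to matrices *)

Section Representations.

Variables (K : fieldType) (V : vectType K) (rho : representation V).

Section Basis.
Variables (n : nat) (e : n.-tuple V) (e_basis : basis_of {:V} e).
Local Notation mat g := (matrix_in_basis e (rho g)).

Lemma rep_matrixM x y : mat (x * y)%g = mat x *m mat y.
Proof. by rewrite repM matrix_in_basis_comp. Qed.

Lemma rep_matrix_unit x : mat x \in unitmx.
Proof.
have E : mat x *m mat x^-1%g = 1%:M.
  by rewrite -rep_matrixM mulgV rep1 matrix_in_basis_id.
by case: (mulmx1_unit E).
Qed.
End Basis.

Section Dimension3.
Variables (e : 3.-tuple V) (e_basis : basis_of {:V} e).
Local Notation A := (matrix_in_basis e (rho sigma1)).
Local Notation B := (matrix_in_basis e (rho sigma2)).

Lemma rep_braid_pair : braid_pair A B.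
Proof.
split; try exact: rep_matrix_unit.
by rewrite -!rep_matrixM // B3_braid.
Qed.

(** The columns of the base change P are the coordinates of a basis f of V; the
    summands are the spans of f_0 and of f_1, f_2. *)
Lemma rep_decomposable : decomposable_pair A B -> decomposable_rep rho.
Proof.
move=> [a [b [c [d [g [a' [b' [c' [d' [g' [P uP [EA EB]]]]]]]]]]]].
pose f i : V := vec_of_col e (col i P).
have f_img (M D : 'M[K]_3) (h : 'End(V)) : matrix_in_basis e h = M ->
    D = invmx P *m M *m P ->
    forall j, h (f j) = \sum_i D i j *: f i.
  move=> EM -> j; rewrite /f matrix_in_basisE // EM colE mulmxA -colE.
  have -> : M *m P = P *m (invmx P *m M *m P) by rewrite !mulmxA mulmxV ?mul1mx.
  set D' := invmx P *m M *m P.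
  have -> : col j (P *m D') = \sum_i D' i j *: col i P.
    apply/colP=> k; rewrite !mxE summxE.
    by apply: eq_bigr => i _; rewrite !mxE mulrC.
  by rewrite linear_sum; apply: eq_bigr => i _; rewrite linearZ.
have f_free : free [:: f 0; f 1; f 2].
  rewrite -[X in free X]/(tval [tuple f 0; f 1; f 2]).
  apply/freeP => k k0.
  suff /colP kE : \col_i k i = 0 by move=> i; have := kE i; rewrite !mxE.
  rewrite -[LHS](mulKmx uP) [X in _ *m X](_ : _ = 0) ?mulmx0 //.
  apply: (vec_of_col_inj e_basis); rewrite linear0 -{}[RHS]k0.
  have -> : P *m \col_i k i = \sum_i k i *: col i P.
    apply/colP=> i; rewrite !mxE summxE.
    by apply: eq_bigr => j _; rewrite !mxE mulrC.
  rewrite linear_sum !big_ord_recl !big_ord0 /= !linearZ /f.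
  by do ![congr (_ + _)]; congr (_ *: vec_of_col _ (col _ _)); apply: val_inj.
have dimV : \dim {:V} = 3%N by rewrite (size_basis e_basis).
pose U1 := <[(f 0)%R]>%VS; pose U2 := <<[:: (f 1)%R; (f 2)%R]>>%VS.
have inv (h : 'End(V)) z1 z2 z3 z4 z5 :
    (forall j, h (f j) = \sum_i
       mx3 [:: [:: z1; 0; 0]; [:: 0; z2; z3]; [:: 0; z4; z5]] i j *: f i) ->
    (h @: U1 <= U1)%VS /\ (h @: U2 <= U2)%VS.
  have f12 : lift 0 0 = 1 :> 'I_3 by apply: val_inj.
  have f22 : lift 0 (lift 0 0) = 2 :> 'I_3 by apply: val_inj.
  move=> hf; split.
    rewrite limg_line -memvE hf !big_ord_recl big_ord0 !mxE /=.
    by rewrite !scale0r !addr0 memvZ // memv_line.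
  have f1 : f 1 \in U2 by apply: memv_span; rewrite !inE eqxx.
  have f2 : f 2 \in U2 by apply: memv_span; rewrite !inE eqxx orbT.
  rewrite limg_span; apply/span_subvP => v.
  rewrite /= !inE => /orP[] /eqP->; rewrite hf !big_ord_recl big_ord0 !mxE /=;
    by rewrite f22 f12 scale0r add0r addr0 rpredD // memvZ.
have [A1 A2] := inv _ _ _ _ _ _ (f_img _ _ _ erefl EA).
have [B1 B2] := inv _ _ _ _ _ _ (f_img _ _ _ erefl EB).
have := f_free; rewrite -cat1s cat_free => /and3P[fr1 fr2 dU].
have d1 : \dim U1 = 1%N by rewrite /U1 -span_seq1; exact/eqP.
have d2 : \dim U2 = 2%N by exact/eqP.
exists U1, U2; split=> //.
- by split=> E; [move: d1|move: d2]; rewrite E dimv0.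
- by split=> E; [move: d1|move: d2]; rewrite E dimV.
- rewrite span_seq1 in dU; split; first exact/directv_addP.
  apply/eqP; rewrite eqEdim subvf dimV (directvP dU) /=.
  by rewrite d1 d2.
Qed.

Lemma rep_common_eigenvector (W : {vspace V}) :
  invariant_subspace rho W -> \dim W = 1%N ->
  exists (w : 'cV[K]_3) (l l' : K),
    [/\ w != 0, A *m w = l *: w & B *m w = l' *: w].
Proof.
move=> [W1 W2] dW.
have [v v0 EW] : exists2 v, v != 0 & W = <[v]>%VS.
  exists (vpick W); first by rewrite vpick0 -dimv_eq0 dW.
  apply/eqP; rewrite eq_sym eqEdim -memvE memv_pick dim_vline vpick0.
  by rewrite -dimv_eq0 dW.
have [x Ex] : exists x, vec_of_col e x = v.
  by exists (\col_i coord e i v); rewrite vec_of_coords.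
have img (h : 'End(V)) : (h @: W <= W)%VS ->
    exists l, matrix_in_basis e h *m x = l *: x.
  rewrite EW limg_line -memvE => /vlineP[l El]; exists l.
  apply: (vec_of_col_inj e_basis).
  by rewrite -matrix_in_basisE // Ex El linearZ /= Ex.
have [l El] := img _ W1; have [l' El'] := img _ W2.
exists x, l, l'; split=> //; apply: contraNneq v0 => x0.
by rewrite -Ex x0 linear0.
Qed.
End Dimension3.

End Representations.

Theorem theorem3 (K : closedFieldType) (charK : [pchar K] =i pred0)
    (V : vectType K) (dimV : \dim {:V} = 3%N)
    (rho : representation V) (rho_si : strictly_indecomposable rho)
    (W : {vspace V}) (W_min : minimal_invariant rho W) (dimW : \dim W = 1%N)
    (e : 3.-tuple V) (e_basis : basis_of {:V} e) :
  exists A B : 'M[K]_3,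
    normal_form A B /\
    equivalent_pairs (matrix_in_basis e (rho sigma1))
                     (matrix_in_basis e (rho sigma2)) A B.
Proof.
have two0 : (2 : K) != 0 by rewrite ((pcharf0P K).1 charK).
have three0 : (3 : K) != 0 by rewrite ((pcharf0P K).1 charK).
have [W_inv _ _] := W_min.
have [w [l [l' [w0 Aw Bw]]]] := rep_common_eigenvector e_basis W_inv dimW.
have [dec|//] := classify_common_eigenvector two0 three0
                   (rep_braid_pair rho e_basis) w0 Aw Bw.
by case: rho_si => [[]]; apply: rep_decomposable dec.
Qed.
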